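(* Let $a>0$, $\varphi\in\mathbb R$, let $\mathbf e\in\mathbb R^3$ be a unit vector and put $c=a^2$. Then the function $\mathbf u:\mathbb R\times\mathbb R\to\mathbb R^3$, $$\mathbf u(x,t)=\frac{a}{\cosh\big(a(x-ct)-\varphi\big)}\,\mathbf e ,$$ is a solution, for all $(x,t)\in\mathbb R^2$, of the vector modified Korteweg-de Vries equation $$\partial_t \mathbf u+6\,\mathbf u\times\partial_x^2\mathbf u+6\big(\mathbf u\,\partial_x|\mathbf u|^2-|\mathbf u|^2\,\partial_x\mathbf u\big)+\partial_x^3\mathbf u=0 .$$
   Context: Here $\times$ is the vector (cross) product in $\mathbb R^3$ and $|\cdot|$ is the Euclidean norm. This is the single-soliton solution, with amplitude $a$, speed $c$, phase $\varphi$ and constant direction $\mathbf e$. *)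

(* Defs.v *)
From HB Require Import structures.
From mathcomp Require Import all_boot all_order all_algebra.
From mathcomp Require Import all_classical all_reals all_analysis.

Set Implicit Arguments.
Unset Strict Implicit.
Unset Printing Implicit Defensive.

Import Order.TTheory GRing.Theory Num.Theory.
Import numFieldNormedType.Exports.

Local Open Scope ring_scope.

Definition cosh (R : realType) (x : R) : R := (expR x + expR (- x)) / 2.

(* The canonical norm `|v| on 'rV[R]_3 is the sup norm, hence this separate
   Euclidean norm. The sup norm is only used through the topology it induces,
   which is the usual one, when differentiating curves in 'rV[R]_3. *)
Definition enorm (R : realType) (v : 'rV[R]_3) : R :=
  Num.sqrt (\sum_(i < 3) v 0 i ^+ 2).

(* Indices in 'I_3 are added modulo 3, so the component 0 is
   v_1 w_2 - v_2 w_1, and the others follow cyclically. *)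
Definition crossmul (R : realType) (v w : 'rV[R]_3) : 'rV[R]_3 :=
  \row_(i < 3) (v 0 (i + 1) * w 0 (i + 2) - v 0 (i + 2) * w 0 (i + 1)).

Section Mkdv.
Variables (R : realType) (u : R -> R -> 'rV[R]_3).

Definition dt (x t : R) : 'rV[R]_3 := ((u x)^`())%classic t.

Definition dx (n : nat) (x t : R) : 'rV[R]_3 := ((u ^~ t)^`(n))%classic x.

Definition sqnorm (x t : R) : R := enorm (u x t) ^+ 2.

Definition dx_sqnorm (x t : R) : R := ((sqnorm ^~ t)^`())%classic x.

(* Since f^`() is total, the existence of the derivatives occurring in the
   equation has to be required explicitly. *)
Definition mkdv_regular_at (x t : R) : Prop :=
  [/\ derivable (u x) t 1,
      forall k, (k < 3)%N -> derivable (dx k ^~ t) x 1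
    & derivable (sqnorm ^~ t) x 1].

Definition mkdv_equation_at (x t : R) : Prop :=
  dt x t + 6 *: crossmul (u x t) (dx 2 x t)
  + 6 *: (dx_sqnorm x t *: u x t - sqnorm x t *: dx 1 x t)
  + dx 3 x t = 0.

Definition vector_mkdv_solution : Prop :=
  forall x t : R, mkdv_regular_at x t /\ mkdv_equation_at x t.

End Mkdv.

(* Main.v *)
(** Along a constant direction the cross product vanishes and the equation
    reduces to the scalar mKdV equation [f_t + 6 f^2 f_x + f_xxx = 0].  For
    [f = a S], with [S = sech] and [T = tanh] of a phase that is affine in [x]
    and [t], the rules [S' = - S T], [T' = S^2] turn the left-hand side into
    [a^4 S T (1 - S^2 - T^2)], which is zero. *)

Require Import Defs.
From mathcomp Require Import all_boot all_order all_algebra.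
From mathcomp Require Import all_classical all_reals all_analysis.
From mathcomp Require Import ring lra.
Import Order.TTheory GRing.Theory Num.Theory.
Import numFieldNormedType.Exports.
Local Open Scope ring_scope.

Lemma is_derive_derive1 {R : numFieldType} {V : normedModType R}
    {f df : R -> V} :
  (forall x : R, is_derive x 1 f (df x)) -> (f^`())%classic = df.
Proof. by move=> fdf; apply/funext => x; rewrite derive1E derive_val. Qed.

(** The curve is [f] followed by the linear map [k => k *: e], which is its own differential, so the
    chain rule applies. *)
Lemma is_derive_scalel {R : numFieldType} {V : normedModType R}
    (f : R -> R) (e : V) (x df : R) :
  is_derive x 1 f df -> is_derive x 1 (fun y => f y *: e) (df *: e).
Proof.
case=> /derivable1_diffP fx <-.
have gx : differentiable (fun y => f y *: e) x.
  exact: (differentiable_comp fx (g := fun k : R => k *: e)).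
apply: DeriveDef; first exact/derivable1_diffP.
rewrite !deriveE // (diff_comp fx (g := fun k : R => k *: e)) //=.
by rewrite diff_val.
Qed.

Lemma is_derive_affine {R : realType} {f : R -> R} {df : R} {k b x : R} :
  is_derive (k * x + b) 1 f df ->
  is_derive x 1 (fun y => f (k * y + b)) (k * df).
Proof.
move=> fdf; rewrite mulrC.
apply: (@is_derive1_comp _ f (fun y => k * y + b)).
rewrite (_ : (fun y => _) = k \*: id + cst b)//.
by apply: is_derive_eq; rewrite addr0 [k *: 1]mulr1.
Qed.

Section HyperbolicFunctions.
Context {R : realType}.
Implicit Types x : R.

Definition sinh x : R := (expR x - expR (- x)) / 2.
Definition sech x : R := (cosh x)^-1.
Definition tanh x : R := sinh x / cosh x.

Lemma cosh_gt0 x : 0 < cosh x.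
Proof. by rewrite divr_gt0 ?addr_gt0 ?expR_gt0. Qed.

Lemma cosh_sqrB_sinh x : cosh x ^+ 2 - sinh x ^+ 2 = 1.
Proof.
(* Writing 1 as [expR x * expR (- x)] leaves an identity that is polynomial in the two
   exponentials. *)
rewrite -[RHS]expR0 -(subrr x) expRD.
by rewrite /cosh /sinh; field.
Qed.

Lemma sech_sqrD_tanh x : sech x ^+ 2 + tanh x ^+ 2 = 1.
Proof.
have c0 := lt0r_neq0 (cosh_gt0 x).
rewrite /sech /tanh; apply: (mulfI (expf_neq0 2 c0)).
rewrite [RHS]mulr1 -[RHS](subrK (sinh x ^+ 2)) cosh_sqrB_sinh.
by field.
Qed.

Lemma is_derive_expRN x : is_derive x 1 (fun y => expR (- y)) (- expR (- x)).
Proof.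
by rewrite -mulrN1; apply: (@is_derive1_comp _ expR -%R).
Qed.

Lemma is_derive_cosh x : is_derive x 1 (@cosh R) (sinh x).
Proof.
have := is_derive_expRN x => dN.
rewrite (_ : @cosh R = 2^-1 \*: (expR + (fun y => expR (- y)))).
  by apply: is_derive_eq; rewrite /sinh mulrC.
by apply/funext => y; rewrite /cosh mulrC.
Qed.

Lemma is_derive_sinh x : is_derive x 1 sinh (cosh x).
Proof.
have := is_derive_expRN x => dN.
rewrite (_ : sinh = 2^-1 \*: (expR - (fun y => expR (- y)))).
  by apply: is_derive_eq; rewrite /cosh opprK mulrC.
by apply/funext => y; rewrite /sinh mulrC.
Qed.

Lemma is_derive_sech x : is_derive x 1 sech (- (sech x * tanh x)).
Proof.
have c0 := lt0r_neq0 (cosh_gt0 x).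
apply: is_derive_eq; first exact: (is_deriveV c0 (is_derive_cosh x)).
by rewrite /sech /tanh /GRing.scale/=; field.
Qed.

Lemma is_derive_tanh x : is_derive x 1 tanh (sech x ^+ 2).
Proof.
have c0 := lt0r_neq0 (cosh_gt0 x).
have ds := is_derive_sinh x; have dS := is_derive_sech x.
rewrite (_ : tanh = sinh * sech)//.
apply: is_derive_eq.
(* The product rule yields [1 - tanh x ^+ 2], so the target is first brought to that form. *)
rewrite -[RHS](addrK (tanh x ^+ 2)) sech_sqrD_tanh /tanh /sech /GRing.scale/=.
by field.
Qed.

End HyperbolicFunctions.

Section Soliton.
Context {R : realType}.
Implicit Types x : R.

Definition sech_d1 x : R := - (sech x * tanh x).
Definition sech_d2 x : R := sech x * tanh x ^+ 2 - sech x ^+ 3.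
Definition sech_d3 x : R := 5 * sech x ^+ 3 * tanh x - sech x * tanh x ^+ 3.

Lemma is_derive_sech_d1 x : is_derive x 1 sech_d1 (sech_d2 x).
Proof.
have dS := is_derive_sech x; have dT := is_derive_tanh x.
rewrite (_ : sech_d1 = - (@sech R * @tanh R))//.
by apply: is_derive_eq; rewrite /sech_d2 /GRing.scale/=; ring.
Qed.

Lemma is_derive_sech_d2 x : is_derive x 1 sech_d2 (sech_d3 x).
Proof.
have dS := is_derive_sech x; have dT := is_derive_tanh x.
rewrite (_ : sech_d2 = @sech R * @tanh R ^+ 2 - @sech R ^+ 3)//.
by apply: is_derive_eq; rewrite exprfctE /sech_d3 /GRing.scale/=; ring.
Qed.

(** This is the scalar equation for the wave sech(x - t) of amplitude and speed 1: the last term is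
    its time derivative. *)
Lemma sech_mkdv x :
  sech_d3 x + 6 * (sech x ^+ 2 * sech_d1 x) - sech_d1 x = 0.
Proof.
have h := sech_sqrD_tanh x.
rewrite (_ : _ - _ = sech x * tanh x *
  (1 - (sech x ^+ 2 + tanh x ^+ 2))); first by rewrite h subrr mulr0.
by rewrite /sech_d3 /sech_d1; ring.
Qed.

End Soliton.

Lemma crossmul_collinear (R : realType) (r s : R) (e : 'rV[R]_3) :
  crossmul (r *: e) (s *: e) = 0.
Proof. by apply/rowP => i; rewrite !mxE; ring. Qed.

Lemma enorm_sqrZ (R : realType) (r : R) (e : 'rV[R]_3) :
  enorm (r *: e) ^+ 2 = r ^+ 2 * enorm e ^+ 2.
Proof.
rewrite /enorm !sqr_sqrtr; [|by apply: sumr_ge0 => i _; exact: sqr_ge0..].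
by rewrite mulr_sumr; apply: eq_bigr => i _; rewrite mxE exprMn.
Qed.

Theorem mainTheorem1 (R : realType) (a c phi : R) (e : 'rV[R]_3)
    (a_gt0 : 0 < a) (e_unit : enorm e = 1) (cE : c = a ^+ 2) :
  vector_mkdv_solution
    (fun x t : R => (a / cosh (a * (x - c * t) - phi)) *: e).
Proof.
move=> x t.
set u := fun _ => _.
(* At a fixed time [s] the phase is affine in space, with slope [a] and offset [b s]. *)
pose b s := - (a * c * s) - phi.
have uE s : u ^~ s = fun y => (a * sech (a * y + b s)) *: e.
  by apply/funext => y; rewrite /u /b /sech; congr ((_ / cosh _) *: _); ring.
(* Each space derivative brings one more factor [a]; [k] holds the factors accumulated so far, so
   one rule serves all three orders. *)
have step k (f df : R -> R) (fdf : forall y : R, is_derive y 1 f (df y)) (y : R) :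
    is_derive y 1 (fun z => (k * f (a * z + b t)) *: e)
                  ((k * a * df (a * y + b t)) *: e).
  apply: is_derive_scalel; rewrite -mulrA.
  have dfa := is_derive_affine (fdf (a * y + b t)).
  exact: is_deriveZ.
have d1 := step a _ _ (@is_derive_sech R).
have d2 := step (a * a) _ _ (@is_derive_sech_d1 R).
have d3 := step (a * a * a) _ _ (@is_derive_sech_d2 R).
have dx0E : dx u 0 ^~ t = fun y => (a * sech (a * y + b t)) *: e.
  exact: uE.
have dx1E : dx u 1 ^~ t = fun y => (a * a * sech_d1 (a * y + b t)) *: e.
  by rewrite -(is_derive_derive1 d1) -dx0E.
have dx2E : dx u 2 ^~ t = fun y => (a * a * a * sech_d2 (a * y + b t)) *: e.
  by rewrite -(is_derive_derive1 d2) -dx1E.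
have dx3E : dx u 3 ^~ t =
    fun y => (a * a * a * a * sech_d3 (a * y + b t)) *: e.
  by rewrite -(is_derive_derive1 d3) -dx2E.
(* In time the phase has slope [- (a * c)]; with the amplitude [a] and c = a^2 this gives the factor
   -a^4. *)
have dtu : is_derive t 1 (u x) (- (a ^+ 4 * sech_d1 (a * x + b t)) *: e).
  rewrite (_ : u x = fun s => (a * sech (- (a * c) * s + (a * x - phi))) *: e).
    apply: is_derive_scalel.
    have -> : a * x + b t = - (a * c) * t + (a * x - phi) by rewrite /b; ring.
    have dfa := is_derive_affine (is_derive_sech (- (a * c) * t + (a * x - phi))).
    apply: is_derive_eq.
    by rewrite cE /sech_d1 /GRing.scale/=; ring.
  by apply/funext => s; rewrite /u /sech; congr ((_ / cosh _) *: _); ring.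
have sqE : sqnorm u ^~ t = fun y => (a * sech (a * y + b t)) ^+ 2.
  apply/funext => y; rewrite /sqnorm -[u y t]/((u ^~ t) y) uE enorm_sqrZ.
  by rewrite e_unit expr1n mulr1.
have dsq (y : R) : is_derive y 1 (sqnorm u ^~ t)
    (2 * a ^+ 3 * sech (a * y + b t) * sech_d1 (a * y + b t)).
  have dfa := is_derive_affine (is_derive_sech (a * y + b t)).
  rewrite sqE (_ : (fun z => _) = (a \*: fun z => sech (a * z + b t)) ^+ 2)//.
  apply: is_derive_eq.
  by rewrite /sech_d1 /GRing.scale/= /GRing.scale/=; ring.
split.
  split=> [|[|[|[|//]]] _|].
  - by case: dtu.
  - by rewrite dx0E; case: (d1 x).
  - by rewrite dx1E; case: (d2 x).
  - by rewrite dx2E; case: (d3 x).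
  - by case: (dsq x).
rewrite /mkdv_equation_at /dx_sqnorm (is_derive_derive1 dsq).
rewrite /dt derive1E derive_val.
(* The formulas above equate functions of space at the fixed time [t]; here they are evaluated at
   [x]. *)
have at_x (V : Type) (f g : R -> V) : f = g -> f x = g x by move->.
rewrite (at_x _ _ _ (uE t)) (at_x _ _ _ sqE) (at_x _ _ _ dx1E).
rewrite (at_x _ _ _ dx2E) (at_x _ _ _ dx3E) crossmul_collinear scaler0 addr0.
(* Every remaining term is a multiple of [e]. The nonlinear part contributes 12 - 6 = 6 times a^4
   S^2 S', so the total coefficient is a^4 times the left-hand side of [sech_mkdv]. *)
rewrite !scalerA -scalerBl scalerA -!scalerDl.
have h := sech_mkdv (a * x + b t).
move: (sech _) (sech_d1 _) (sech_d3 _) h => s s1 s3 h.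
rewrite (_ : _ + _ = 0) ?scale0r//.
rewrite (_ : s3 = s1 - 6 * (s ^+ 2 * s1)); last by lra.
ring.
Qed.
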